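(* Let $n$ be a positive integer. For each $k$ from $1$ to $n$ let $B_k$ be a subset of $K_n-\{\vec 0\}$ containing an even number of $k$-odd vectors. Let $L$ be an $n\times n$ symmetric matrix with elements in $\mathbb{Z}/2\mathbb{Z}$ such that the entries on the main diagonal are all zero. Then there exists an $n$-component Gauss phrase $p$ such that $B_k(p)=B_k$ for all $k$ from $1$ to $n$ and the linking matrix of $p$ is $L$.
   Context: A word on an alphabet (finite set) $\mathcal{A}$ is a finite, possibly empty, sequence of letters of $\mathcal{A}$. A Gauss word on $\mathcal{A}$ is a word on $\mathcal{A}$ in which every letter of $\mathcal{A}$ appears exactly twice. A Gauss phrase on $\mathcal{A}$ is a finite sequence of words $x_1,\dots,x_m$ on $\mathcal{A}$ whose concatenation $x_1x_2\cdots x_m$ is a Gauss word on $\mathcal{A}$; the $x_i$ are its components. Linking matrix: for an $n$-component Gauss phrase, this is the symmetric $n\times n$ matrix $(l_{ij})$ over $\mathbb{Z}/2\mathbb{Z}$ with $l_{ii}=0$ for all $i$ and, for $i\neq j$, $l_{ij}$ equal to the number, modulo $2$, of letters that appear once in the $i$th component and once in the $j$th component. Write $K_n=(\mathbb{Z}/2\mathbb{Z})^n$. A vector in $K_n$ is $k$-odd if its $k$th entry is $1$. Let $p$ be an $n$-component Gauss phrase. For a (contiguous) subword $w$ of a component of $p$, the linking vector $\overrightarrow{l(w)}\in K_n$ is the vector whose $i$th entry is the number, modulo $2$, of letters which occur exactly once in $w$ and whose other occurrence is in the $i$th component of $p$. A single-component letter is a letter both of whose occurrences are in the same component. If $A$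 is a single-component letter in the $k$th component, that component has the form $xAyAz$ with $x,y,z$ possibly empty words, and the linking vector of $A$ is $\overrightarrow{l(A)}=\overrightarrow{l(y)}$. Let $\mathcal{A}_k$ be the set of single-component letters appearing in the $k$th component of $p$, and for $\vec v\in K_n$ let $d_k(\vec v)=\#\{X\in\mathcal{A}_k : \overrightarrow{l(X)}=\vec v\}$. Define $$B_k(p)=\{\vec v\in K_n-\{\vec 0\} : d_k(\vec v)\text{ is odd}\}.$$ *)

(* Defs.v *)
From mathcomp Require Import all_boot all_order all_algebra.

Set Implicit Arguments.
Unset Strict Implicit.
Unset Printing Implicit Defensive.

Import GRing.Theory.
Local Open Scope ring_scope.

Definition gauss_word (A : finType) (w : seq A) : bool :=
  [forall a : A, count_mem a w == 2%N].

Definition gauss_phrase (A : finType) (n : nat) (p : n.-tuple (seq A)) : bool :=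
  gauss_word (flatten p).

Definition linking_matrix (A : finType) (n : nat) (p : n.-tuple (seq A)) :
    'M['F_2]_n :=
  \matrix_(i, j)
    (if i == j then 0
     else #|[set a : A | (count_mem a (tnth p i) == 1%N)
                         && (count_mem a (tnth p j) == 1%N)]|%:R).

(* An occurrence of a subword in the word c is given by the position s of its
   first letter and its length l; [outer] is what remains of c around it. *)
Definition subword (A : Type) (c : seq A) (s l : nat) : seq A :=
  take l (drop s c).

Definition outer (A : Type) (c : seq A) (s l : nat) : seq A :=
  take s c ++ drop (s + l) c.

Lemma subword_cat (A : Type) (x w z : seq A) :
  subword (x ++ w ++ z) (size x) (size w) = w.
Proof. by rewrite /subword drop_size_cat // take_size_cat. Qed.

Lemma outer_cat (A : Type) (x w z : seq A) :
  outer (x ++ w ++ z) (size x) (size w) = x ++ z.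
Proof.
by rewrite /outer take_size_cat // catA drop_size_cat // size_cat.
Qed.

(* For a letter occurring exactly once in the subword w of the kth component,
   the other occurrence lies in the ith component: anywhere in it if i != k,
   outside w if i = k. *)
Definition linking_vector (A : finType) (n : nat) (p : n.-tuple (seq A))
    (k : 'I_n) (s l : nat) : 'rV['F_2]_n :=
  \row_i #|[set a : A | (count_mem a (subword (tnth p k) s l) == 1%N)
                        && (a \in (if i == k then outer (tnth p k) s l
                                   else tnth p i))]|%:R.

(* If c = x a y a z with a occurring exactly twice, then y starts at position
   [mid_start c a] and has length [mid_length c a]. *)
Definition mid_start (A : eqType) (c : seq A) (a : A) : nat := (index a c).+1.

Definition mid_length (A : eqType) (c : seq A) (a : A) : nat :=
  index a (drop (mid_start c a) c).

Lemma subword_mid (A : eqType) (x y z : seq A) (a : A) :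
  let c := x ++ a :: y ++ a :: z in
  count_mem a c = 2%N -> subword c (mid_start c a) (mid_length c a) = y.
Proof.
move=> c; rewrite /c !count_cat /= count_cat /= eqxx => cnt.
move: cnt; rewrite !add1n !addnS => -[/eqP]; rewrite !addn_eq0.
case/and3P=> /eqP/count_memPn ax /eqP/count_memPn ay _.
have ms : mid_start (x ++ a :: y ++ a :: z) a = size (rcons x a).
  by rewrite /mid_start index_cat (negPf ax) /= eqxx addn0 size_rcons.
have ml : mid_length (x ++ a :: y ++ a :: z) a = size y.
  rewrite /mid_length ms -cat_rcons drop_size_cat // index_cat (negPf ay) /=.
  by rewrite eqxx addn0.
by rewrite ml ms -cat_rcons subword_cat.
Qed.

Definition letter_vector (A : finType) (n : nat) (p : n.-tuple (seq A))
    (k : 'I_n) (a : A) : 'rV['F_2]_n :=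
  linking_vector p k (mid_start (tnth p k) a) (mid_length (tnth p k) a).

Definition single_letters (A : finType) (n : nat) (p : n.-tuple (seq A))
    (k : 'I_n) : {set A} :=
  [set a | count_mem a (tnth p k) == 2%N].

Definition letter_count (A : finType) (n : nat) (p : n.-tuple (seq A))
    (k : 'I_n) (v : 'rV['F_2]_n) : nat :=
  #|[set a in single_letters p k | letter_vector p k a == v]|.

Definition odd_vectors (A : finType) (n : nat) (p : n.-tuple (seq A))
    (k : 'I_n) : {set 'rV['F_2]_n} :=
  [set v | (v != 0) && odd (letter_count p k v)].

Definition is_kodd (n : nat) (k : 'I_n) (v : 'rV['F_2]_n) : bool :=
  v ord0 k == 1.

(* Main.v *)
Require Import Defs.
From mathcomp Require Import all_boot all_order all_algebra.

(* Concatenating phrases over disjoint alphabets componentwise adds the linking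
   matrices and the letter counts, so modulo 2 the realizable invariants form a
   group and it is enough to realize generators.  Letters shared by two different
   components realize any linking matrix without affecting any B_k.  For v not
   k-odd, the kth component A X A with the letters of X completed in the other
   components gives B_k = {v}; for v k-odd, A X B A B gives {v} + {e_k}, where e_k
   is the kth unit vector.  Summing over v in B_k, the copies of e_k cancel
   because the number of k-odd vectors is even. *)

Set Implicit Arguments.
Unset Strict Implicit.
Unset Printing Implicit Defensive.

Import GRing.Theory.
Local Open Scope ring_scope.

(** * Parities, cardinals and occurrence counts *)

Lemma natr_F2 (m : nat) : m%:R = (odd m)%:R :> 'F_2.
Proof. by apply: val_inj; rewrite /= !val_Fp_nat // !modn2 oddb. Qed.

Lemma natrb_F2 (x : 'F_2) : (x == 1)%:R = x.
Proof. by case: x => [[|[|m]] lt_m2] //; apply: val_inj. Qed.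

Lemma card_set_sum (A1 A2 : finType) (P : pred (A1 + A2)) :
  #|[set c | P c]| = (#|[set a | P (inl a)]| + #|[set b | P (inr b)]|)%N.
Proof.
rewrite -!sum1_card big_sumType.
by congr (_ + _)%N; apply: eq_bigl => a; rewrite !inE.
Qed.

Lemma card_set_sig (T : finType) (P : pred T) (y : T) :
  #|[set x : {z | P z} | val x == y]| = P y.
Proof.
case: (boolP (P y)) => [Py | nPy].
  rewrite (_ : [set _ | _] = [set Sub y Py]) ?cards1 //.
  by apply/setP=> x; rewrite !inE -val_eqE.
apply: eq_card0 => x; rewrite inE; apply: contraNF nPy => /eqP <-.
exact: valP.
Qed.

Lemma sum_nat_eq (T : finType) (P : pred T) (a : T) :
  (\sum_(i | P i) (a == i) = P a)%N.
Proof.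
have [Pa | nPa] := boolP (P a); last first.
  by rewrite big1 // => i Pi; case: eqP nPa => // ->; rewrite Pi.
rewrite (bigD1 a) //= eqxx big1 // => i /andP[_].
by rewrite eq_sym => /negPf ->.
Qed.

Lemma count_mem_map_inj (T U : eqType) (f : T -> U) (s : seq T) (a : T) :
  injective f -> count_mem (f a) (map f s) = count_mem a s.
Proof. by move=> f_inj; rewrite count_map; apply: eq_count => b /=; rewrite inj_eq. Qed.

Lemma count_mem_map_neq (T U : eqType) (f : T -> U) (s : seq T) (b : U) :
  (forall a, f a != b) -> count_mem b (map f s) = 0%N.
Proof.
move=> f_neq; rewrite count_map (eq_count (a2 := pred0)) ?count_pred0 //.
by move=> a /=; apply: negPf.
Qed.

Lemma count_mem2_split (T : eqType) (a : T) (c : seq T) :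
  count_mem a c = 2%N -> exists x y z, c = x ++ a :: y ++ a :: z.
Proof.
move=> c2; have a_c : a \in c by rewrite -has_pred1 has_count c2.
case/splitPr: a_c c2 => x t; rewrite count_cat /= eqxx.
(* The chosen occurrence may be either of the two, so the other one is sought to its right, then to
   its left. *)
have [/splitPr[y z] _ | /count_memPn t0] := boolP (a \in t); first by exists x, y, z.
have [/splitPr[x1 x2] _ | /count_memPn x0] := boolP (a \in x); last by rewrite x0 t0.
by exists x1, x2, t; rewrite -catA.
Qed.

Lemma gauss_phraseE (A : finType) (n : nat) (p : n.-tuple (seq A)) :
  gauss_phrase p = [forall a, \sum_i count_mem a (tnth p i) == 2]%N.
Proof.
apply: eq_forallb => a; rewrite count_flatten sumnE big_map.
by rewrite big_tuple.
Qed.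

(** Replaces positions by an explicit factorization. As [a] occurs exactly twice, neither [x] nor
    [y] contains it, so the two [index] searches stop at the displayed copies. *)
Lemma letter_vector_split (A : finType) (n : nat) (p : n.-tuple (seq A))
    (k : 'I_n) (a : A) (x y z : seq A) :
    tnth p k = x ++ a :: y ++ a :: z -> count_mem a (tnth p k) = 2%N ->
  letter_vector p k a =
    \row_i #|[set b | (count_mem b y == 1%N)
                && (b \in if i == k then x ++ [:: a, a & z] else tnth p i)]|%:R.
Proof.
move=> pk; rewrite /letter_vector pk => cnt.
apply/rowP=> i; rewrite !mxE pk subword_mid //.
congr _%:R; apply: eq_card => b; rewrite !inE; congr (_ && (b \in _)).
case: eqP => // _.
suff [-> ->] : mid_start (x ++ a :: y ++ a :: z) a = size (rcons x a) /\
   mid_length (x ++ a :: y ++ a :: z) a = size y.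
  by rewrite -cat_rcons outer_cat cat_rcons.
move: cnt; rewrite count_cat /= count_cat /= eqxx !add1n !addnS => -[/eqP].
rewrite !addn_eq0 => /and3P[/eqP/count_memPn ax /eqP/count_memPn ay _].
have ms : mid_start (x ++ a :: y ++ a :: z) a = size (rcons x a).
  by rewrite /mid_start index_cat (negPf ax) /= eqxx addn0 size_rcons.
split=> //; rewrite /mid_length ms -cat_rcons drop_size_cat // index_cat.
by rewrite (negPf ay) /= eqxx addn0.
Qed.

(** * Sums of phrases over disjoint alphabets *)

Definition phrase_sum (A1 A2 : finType) (n : nat) (p1 : n.-tuple (seq A1))
    (p2 : n.-tuple (seq A2)) : n.-tuple (seq (A1 + A2)) :=
  [tuple map inl (tnth p1 i) ++ map inr (tnth p2 i) | i < n].

Section PhraseSum.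
Variables (A1 A2 : finType) (n : nat).
Variables (p1 : n.-tuple (seq A1)) (p2 : n.-tuple (seq A2)).
Local Notation p := (phrase_sum p1 p2).

Lemma count_phrase_sum_l (i : 'I_n) (a : A1) :
  count_mem (inl a) (tnth p i) = count_mem a (tnth p1 i).
Proof.
rewrite tnth_mktuple count_cat count_mem_map_inj; last exact: inl_inj.
by rewrite count_mem_map_neq ?addn0.
Qed.

Lemma count_phrase_sum_r (i : 'I_n) (a : A2) :
  count_mem (inr a) (tnth p i) = count_mem a (tnth p2 i).
Proof.
rewrite tnth_mktuple count_cat (count_mem_map_inj _ _ (@inr_inj _ _)).
by rewrite count_mem_map_neq.
Qed.

Lemma gauss_phrase_sum : gauss_phrase p1 -> gauss_phrase p2 -> gauss_phrase p.
Proof.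
rewrite !gauss_phraseE => /forallP g1 /forallP g2; apply/forallP=> -[a|a].
  by rewrite (eq_bigr _ (fun i _ => count_phrase_sum_l i a)).
by rewrite (eq_bigr _ (fun i _ => count_phrase_sum_r i a)).
Qed.

Lemma linking_matrix_sum :
  linking_matrix p = linking_matrix p1 + linking_matrix p2.
Proof.
apply/matrixP=> i j; rewrite !mxE; case: eqP => [_|_]; first by rewrite addr0.
rewrite card_set_sum natrD; congr (_%:R + _%:R); apply: eq_card => a.
  by rewrite !inE !count_phrase_sum_l.
by rewrite !inE !count_phrase_sum_r.
Qed.

(** The word between the two copies of [inl a] lies inside the [inl] block of the component, so no
    letter of [p2] enters it. *)
Lemma letter_vector_sum_l (k : 'I_n) (a : A1) :
  count_mem a (tnth p1 k) = 2%N -> letter_vector p k (inl a) = letter_vector p1 k a.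
Proof.
move=> c2; have [x [y [z p1k]]] := count_mem2_split c2.
have pk : tnth p k = map inl x ++ inl a :: map inl y ++
    inl a :: (map inl z ++ map inr (tnth p2 k)).
  by rewrite tnth_mktuple p1k !(map_cat, map_cons) -!(catA, cat_cons).
rewrite (letter_vector_split pk) ?count_phrase_sum_l // (letter_vector_split p1k) //.
apply/rowP=> i; rewrite !mxE card_set_sum [X in (_ + X)%N]eq_card0 ?addn0.
  congr _%:R; apply: eq_card => b.
  rewrite !inE count_mem_map_inj; last exact: inl_inj.
  congr (_ && _); case: eqP => _; rewrite -!has_pred1 !has_count.
    rewrite !count_cat /= count_cat !count_mem_map_inj; try exact: inl_inj.
    by rewrite count_mem_map_neq ?addn0.
  by rewrite count_phrase_sum_l.
by move=> b; rewrite !inE count_mem_map_neq.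
Qed.

Lemma letter_vector_sum_r (k : 'I_n) (a : A2) :
  count_mem a (tnth p2 k) = 2%N -> letter_vector p k (inr a) = letter_vector p2 k a.
Proof.
move=> c2; have [x [y [z p2k]]] := count_mem2_split c2.
have pk : tnth p k = (map inl (tnth p1 k) ++ map inr x) ++ inr a :: map inr y ++
    inr a :: map inr z.
  by rewrite tnth_mktuple p2k !(map_cat, map_cons) -!(catA, cat_cons).
rewrite (letter_vector_split pk) ?count_phrase_sum_r // (letter_vector_split p2k) //.
apply/rowP=> i; rewrite !mxE card_set_sum [X in (X + _)%N]eq_card0 ?add0n.
  congr _%:R; apply: eq_card => b.
  rewrite !inE (count_mem_map_inj _ _ (@inr_inj _ _)).
  congr (_ && _); case: eqP => _; rewrite -!has_pred1 !has_count.
    rewrite !count_cat /= !(count_mem_map_inj _ _ (@inr_inj _ _)).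
    by rewrite count_mem_map_neq.
  by rewrite count_phrase_sum_r.
by move=> b; rewrite !inE count_mem_map_neq.
Qed.

Lemma letter_count_sum (k : 'I_n) (v : 'rV['F_2]_n) :
  letter_count p k v = (letter_count p1 k v + letter_count p2 k v)%N.
Proof.
rewrite /letter_count card_set_sum.
congr (_ + _)%N; apply: eq_card => a; rewrite !inE.
  by rewrite count_phrase_sum_l; case: eqP => //= /letter_vector_sum_l ->.
by rewrite count_phrase_sum_r; case: eqP => //= /letter_vector_sum_r ->.
Qed.

End PhraseSum.

(** * Realizable pairs of invariants and their additivity *)

Lemma tr_linking_matrix (A : finType) (n : nat) (p : n.-tuple (seq A)) :
  (linking_matrix p)^T = linking_matrix p.
Proof.
apply/matrixP=> i j; rewrite !mxE eq_sym; case: eqP => // _.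
by congr _%:R; apply: eq_card => a; rewrite !inE andbC.
Qed.

(* The zero vector is excluded from [odd_vectors], so its count is masked. *)
Definition parity_invariant (A : finType) (n : nat) (p : n.-tuple (seq A)) :
    {ffun 'I_n * 'rV['F_2]_n -> 'F_2} :=
  [ffun kv => if kv.2 == 0 then 0 else (letter_count p kv.1 kv.2)%:R].

Definition realizable (n : nat)
    (x : {ffun 'I_n * 'rV['F_2]_n -> 'F_2} * 'M['F_2]_n) : Prop :=
  exists (A : finType) (p : n.-tuple (seq A)),
    gauss_phrase p /\ (parity_invariant p, linking_matrix p) = x.

Lemma realizableD (n : nat) (x y : {ffun 'I_n * 'rV['F_2]_n -> 'F_2} * 'M['F_2]_n) :
  realizable x -> realizable y -> realizable (x + y).
Proof.
move=> [A1 [p1 [g1 <-]]] [A2 [p2 [g2 <-]]].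
exists (A1 + A2)%type, (phrase_sum p1 p2); split; first exact: gauss_phrase_sum.
rewrite linking_matrix_sum; congr pair; apply/ffunP=> -[k v]; rewrite !ffunE /=.
by case: eqP => _; rewrite ?addr0 // letter_count_sum natrD.
Qed.

(** Take one letter for each pair i < j with [L i j] equal to 1 and write it once in components i
    and j. No letter occurs twice in a component, so the parity invariant vanishes. *)
Lemma realizable_matrix (n : nat) (L : 'M['F_2]_n) :
  L^T = L -> (forall i, L i i = 0) -> realizable (0, L).
Proof.
move=> L_sym L_diag.
have LC i j : L i j = L j i by rewrite -[in LHS]L_sym mxE.
pose T := {ij : 'I_n * 'I_n | (ij.1 < ij.2)%N && (L ij.1 ij.2 == 1)}.
pose incident (x : T) (m : 'I_n) := ((val x).1 == m) || ((val x).2 == m).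
pose p : n.-tuple (seq T) := [tuple [seq x <- enum {: T} | incident x m] | m < n].
have cp x m : count_mem x (tnth p m) = incident x m.
  rewrite tnth_mktuple count_uniq_mem ?filter_uniq -?enumT ?enum_uniq //.
  by rewrite mem_filter mem_enum andbT.
exists _, p; split; last congr (_, _).
- rewrite gauss_phraseE; apply/forallP=> x; rewrite (eq_bigr _ (fun m _ => cp x m)).
  (* The two endpoints of a pair are distinct, so the disjunction in [incident] counts as a sum. *)
  rewrite (eq_bigr (fun m => ((val x).1 == m) + ((val x).2 == m))%N).
    by rewrite big_split /= !sum_nat_eq.
  move=> m _; rewrite /incident; case: eqP => //= <-; case: eqP => // e.
  by have /andP[] := valP x; rewrite e ltnn.
- apply/ffunP=> -[k v]; rewrite !ffunE /=; case: eqP => // _.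
  rewrite /letter_count (_ : [set _ in _ | _] = set0) ?cards0 //.
  by apply/setP=> x; rewrite !inE cp; case: (incident x k).
have key (i j : 'I_n) : (i < j)%N ->
    #|[set a | (count_mem a (tnth p i) == 1%N) && (count_mem a (tnth p j) == 1%N)]|%:R
    = L i j.
  move=> lt_ij; rewrite -[RHS]natrb_F2; congr _%:R.
  (* The condition i < j is restored so that the right-hand side is the predicate defining [T],
     taken at (i, j). *)
  have <- : (i < j)%N && (L i j == 1) = (L i j == 1) :> nat by rewrite lt_ij.
  rewrite -(card_set_sig
    (fun ij : 'I_n * 'I_n => (ij.1 < ij.2)%N && (L ij.1 ij.2 == 1)) (i, j)).
  apply: eq_card => x; rewrite !inE !cp !eqb1.
  have /andP[lt_x _] := valP x; move: lt_x; rewrite /incident.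
  case: (val x) => a b /= lt_ab; rewrite xpair_eqE.
  (* Of the four ways to match i and j with the endpoints a < b, only a = i, b = j respects i <
     j. *)
  apply/andP/andP=> [[/orP[]/eqP ei /orP[]/eqP ej] | [-> ->]]; rewrite ?orbT //.
  - by move: lt_ij; rewrite -ei -ej ltnn.
  - by rewrite ei ej !eqxx.
  - by move: lt_ij; rewrite -ei -ej ltnNge ltnW.
  by move: lt_ij; rewrite -ei -ej ltnn.
apply/matrixP=> i j; rewrite !mxE; case: (ltngtP i j).
- by move=> lt_ij; rewrite -val_eqE ltn_eqF // key.
- move=> lt_ji; rewrite -val_eqE gtn_eqF // LC -key //.
  by congr _%:R; apply: eq_card => a; rewrite !inE andbC.
by move=> /val_inj ->; rewrite eqxx L_diag.
Qed.

(** * Generators concentrated in one component *)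

(** The vector [v 0 k *: delta_mx 0 k] is e_k if v is k-odd and 0 otherwise. One formula thus covers
    both generators: in the second case the mask at 0 removes the extra term. *)
Definition flip_function (n : nat) (k : 'I_n) (v : 'rV['F_2]_n) :
    {ffun 'I_n * 'rV['F_2]_n -> 'F_2} :=
  [ffun kw => if kw.2 == 0 then 0 else
     (kw.1 == k)%:R * ((kw.2 == v)%:R + (kw.2 == v 0 k *: delta_mx 0 k)%:R)].

(* The kth component is [A X B A B] or [A X A B B] according to whether v is
   k-odd, where X contributes the entries of v other than the kth one. In the
   second case the linking vector of B is 0, hence irrelevant, which keeps the
   alphabet independent of the case. *)
Lemma realizable_flip (n : nat) (k : 'I_n) (v : 'rV['F_2]_n)
    (L : 'M['F_2]_n) :
  L^T = L -> (forall i, L i i = 0) -> realizable (flip_function k v, L).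
Proof.
move=> L_sym L_diag.
pose T := {i : 'I_n | (i != k) && (v 0 i == 1)}.
pose X : seq (T + bool) := map inl (enum {: T}).
pose A : T + bool := inr true; pose B : T + bool := inr false.
pose c := if v 0 k == 1 then A :: X ++ [:: B; A; B] else A :: X ++ [:: A; B; B].
pose p : n.-tuple (seq (T + bool)) :=
  [tuple if i == k then c else [seq inl x | x <- enum {: T} & val x == i] | i < n].
have cXl x : count_mem (inl x) X = 1%N.
  rewrite count_mem_map_inj; last exact: inl_inj.
  by rewrite count_uniq_mem ?mem_enum -?enumT ?enum_uniq.
have cXr b : count_mem (inr b) X = 0%N by rewrite count_mem_map_neq.
have ccl x : count_mem (inl x) c = 1%N.
  by rewrite /c; case: eqP => _; rewrite /= count_cat /= cXl.
have ccr b : count_mem (inr b) c = 2%N.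
  by rewrite /c; case: eqP => _; rewrite /= count_cat /= cXr; case: b.
have pk : tnth p k = c by rewrite tnth_mktuple eqxx.
have pl x i : count_mem (inl x) (tnth p i) = ((i == k) + (val x == i))%N.
  rewrite tnth_mktuple; case: eqP => [->|_].
    by rewrite ccl; have /andP[/negPf-> _] := valP x.
  rewrite count_mem_map_inj; last exact: inl_inj.
  rewrite count_uniq_mem ?filter_uniq -?enumT ?enum_uniq //.
  by rewrite mem_filter mem_enum andbT.
have pr b i : count_mem (inr b) (tnth p i) = if i == k then 2%N else 0%N.
  by rewrite tnth_mktuple; case: eqP => // _; rewrite count_mem_map_neq.
have cardT i : i != k -> #|[set x : T | val x == i]|%:R = v 0 i.
  by move=> ik; rewrite card_set_sig ik natrb_F2.
have memE a i : (a \in tnth p i) = (0 < count_mem a (tnth p i))%N.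
  by rewrite -has_pred1 has_count.
have lA : letter_vector p k A = v.
  (* Both shapes of [c] at once: the first copy of [B] precedes the second [A] exactly when v is
     k-odd. *)
  have E : tnth p k = [::] ++ A :: (X ++ nseq (v 0 k == 1) B) ++
       A :: nseq (2 - (v 0 k == 1)) B.
    by rewrite pk /c; case: eqP; rewrite /= ?cats0 -?catA.
  rewrite (letter_vector_split E) ?pk ?ccr //; apply/rowP=> i; rewrite !mxE.
  case: (i =P k) => [->|/eqP ik]; rewrite card_set_sum.
    (* Entry k: the letters of [X] recur only in other components, so [B] alone can contribute, and
       it does when v is k-odd. *)
    rewrite eq_card0 ?add0n; last first.
      by move=> x; rewrite !inE mem_nseq !andbF.
    rewrite -[RHS]natrb_F2; congr _%:R.
    rewrite (_ : [set _ | _] = if v 0 k == 1 then [set false] else set0).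
      by case: eqP; rewrite ?cards1 ?cards0.
    apply/setP=> b; case: eqP => _; rewrite !inE count_cat cXr /=.
      by case: b.
    by [].
  rewrite [X in (_ + X)%N]eq_card0 ?addn0; last first.
    by move=> b; rewrite !inE memE pr (negPf ik) andbF.
  rewrite -(cardT i ik); congr _%:R; apply: eq_card => x.
  rewrite !inE memE pl count_cat cXl count_nseq (negPf ik) add0n lt0b.
  by rewrite mul0n.
have lB : letter_vector p k B = v 0 k *: delta_mx 0 k.
  have [vk|/eqP vk] := eqVneq (v 0 k) 1.
    have E : tnth p k = (A :: X) ++ B :: [:: A] ++ B :: [::].
      by rewrite pk /c vk eqxx.
    rewrite (letter_vector_split E) ?pk ?ccr //; apply/rowP=> i; rewrite !mxE vk mul1r.
    rewrite card_set_sum eq_card0 ?add0n; last by move=> x; rewrite !inE.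
    case: (i =P k) => [_|/eqP ik].
      rewrite (_ : [set _ | _] = [set true]) ?cards1 //.
      by apply/setP=> -[]; rewrite !inE //.
    rewrite eq_card0 // => b.
    by rewrite !inE memE pr (negPf ik) andbF.
  have E : tnth p k = (A :: X ++ [:: A]) ++ B :: [::] ++ B :: [::].
    by rewrite pk /c; case: eqP vk => //= _ _; rewrite -catA.
  rewrite (letter_vector_split E) ?pk ?ccr //; apply/rowP=> i; rewrite !mxE.
  rewrite eq_card0; last by move=> x; rewrite !inE.
  by rewrite -(natrb_F2 (v 0 k)); case: eqP vk => //; rewrite mul0r.
(* The linking matrix of [p] is arbitrary here. Its difference with [L] is symmetric with zero
   diagonal, so adding a phrase with zero parity invariant corrects it. *)
suff real_p : realizable (flip_function k v, linking_matrix p).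
  rewrite (_ : (_, L) =
      (flip_function k v, linking_matrix p) + (0, L - linking_matrix p)).
    apply: realizableD => //; apply: realizable_matrix => [|i].
      by rewrite linearB /= L_sym tr_linking_matrix.
    by rewrite !mxE L_diag eqxx subr0.
  by congr (_, _); rewrite ?addr0 // addrC subrK.
exists (T + bool)%type, p; split; last congr (_, _).
- rewrite gauss_phraseE; apply/forallP=> -[x|b].
    rewrite (eq_bigr _ (fun i _ => pl x i)) big_split /=.
    rewrite sum_nat_eq (eq_bigr (fun i => (k == i) : nat)) ?sum_nat_eq // => i _.
    by rewrite eq_sym.
  by rewrite (eq_bigr _ (fun i _ => pr b i)) -big_mkcond /= big_pred1_eq.
apply/ffunP=> -[j w]; rewrite !ffunE /=; case: eqP => // _.
(* Letters of [T] have index different from k, hence never occur twice in a component; only [A] and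
   [B] are counted. *)
rewrite /letter_count card_set_sum eq_card0 ?add0n; last first.
  move=> x; rewrite !inE pl; case: (j =P k) => [->|_]; last by case: (_ == j).
  by have /andP[/negPf-> _] := valP x.
have [->|jk] := eqVneq j k; last first.
  by rewrite mul0r eq_card0 // => b; rewrite !inE pr (negPf jk).
rewrite mul1r -natrD; congr _%:R; rewrite -sum1_card big_mkcond big_bool /=.
by rewrite !inE !pr eqxx /= lA lB !(eq_sym w); do 2!case: eqP.
Qed.

(** * Summing the generators over the prescribed sets *)

Lemma sum_flip_function (n : nat) (B : 'I_n -> {set 'rV['F_2]_n})
    (k : 'I_n) (w : 'rV['F_2]_n) :
    (forall k, B k \subset [set v | v != 0]) ->
    (forall k, ~~ odd #|[set v in B k | is_kodd k v]|) ->
  (\sum_j \sum_(v in B j) flip_function j v) (k, w) = (w \in B k)%:R.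
Proof.
move=> B_nz B_even; rewrite sum_ffunE (bigD1 k) //= [X in _ + X]big1 ?addr0; last first.
  move=> j jk; rewrite sum_ffunE big1 // => v _; rewrite ffunE /=.
  by rewrite [k == j]eq_sym (negPf jk) mul0r if_same.
rewrite sum_ffunE; under eq_bigr do rewrite ffunE /= eqxx mul1r.
have [-> | w0] := eqVneq w 0.
  rewrite big1 //; case: (boolP (0 \in B k)) => // /(subsetP (B_nz k)).
  by rewrite inE eqxx.
rewrite big_split /= -!natr_sum.
(* As w is nonzero, the extra term of v matches w only if v is k-odd and w = e_k. These matches are
   therefore even in number. *)
rewrite [X in _ + X%:R](_ : _ =
    (w == delta_mx 0%R k) * #|[set v in B k | is_kodd k v]|)%N.
  rewrite natrM [#|_|%:R]natr_F2 (negPf (B_even k)) mulr0 addr0; congr _%:R.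
  exact: sum_nat_eq.
rewrite -sum1_card big_distrr /= [RHS]big_mkcond [LHS]big_mkcond; apply: eq_bigr => v _.
rewrite inE /is_kodd; case: (v \in B k) => //=; have [-> | vk] := eqVneq (v 0 k) 1.
  by rewrite scale1r muln1.
rewrite -(natrb_F2 (v 0 k)) (negPf vk) scale0r.
by rewrite (negPf w0).
Qed.

Theorem proposition5p7 (n : nat) (n_gt0 : (0 < n)%N)
    (B : 'I_n -> {set 'rV['F_2]_n})
    (B_nz : forall k, B k \subset [set v | v != 0])
    (B_even : forall k, ~~ odd #|[set v in B k | is_kodd k v]|)
    (L : 'M['F_2]_n) (L_sym : L^T = L) (L_diag : forall i, L i i = 0) :
  exists (A : finType) (p : n.-tuple (seq A)),
    [/\ gauss_phrase p,
        forall k, odd_vectors p k = B k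
      & linking_matrix p = L].
Proof.
pose f := \sum_j \sum_(v in B j) flip_function j v.
have [A [p [gauss_p [pf pL]]]] : realizable (f, L).
  (* Quantifying over the matrix makes the property additive in [g]: one summand carries the whole
     matrix, the other the zero matrix. *)
  pose P g := forall L : 'M['F_2]_n,
    L^T = L -> (forall i, L i i = 0) -> realizable (g, L).
  suff: P f by apply.
  have P0 : P 0 by exact: realizable_matrix.
  have PD g h : P g -> P h -> P (g + h).
    move=> Pg Ph M M_sym M_diag.
    rewrite (_ : (_, _) = (g, M) + (h, 0)); last by congr (_, _); rewrite addr0.
    by apply: realizableD; [apply: Pg | apply: Ph => [|i]; rewrite ?trmx0 ?mxE].
  apply: big_ind => // j _; apply: big_ind => // v _.
  exact: realizable_flip.
exists A, p; split=> // k; apply/setP=> v; rewrite inE.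
(* Membership is read off from values in F_2. At v = 0 the mask gives 0, so v is outside [B k];
   elsewhere the value is the parity of the letter count. *)
have := sum_flip_function k v B_nz B_even; rewrite -/f -pf ffunE /=.
case: eqP => /= _; rewrite 1?natr_F2; first by case: (v \in B k).
by case: (odd _); case: (v \in B k).
Qed.
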